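(* Let $\mathfrak g$ be a finite-dimensional complex simple Lie algebra and let $\mathfrak L(\mathfrak g)$ be the associated affine-Virasoro Lie algebra. Then every skew-symmetric biderivation of $\mathfrak L(\mathfrak g)$ is inner; that is, for every skew-symmetric biderivation $F$ of $\mathfrak L(\mathfrak g)$ there exists $\lambda\in\mathbb C$ such that $F(x,y)=\lambda[x,y]$ for all $x,y\in\mathfrak L(\mathfrak g)$.
   Context: All vector spaces, algebras and tensor products are over $\mathbb C$. Let $(\cdot,\cdot)$ be the Killing form of $\mathfrak g$. The affine-Virasoro Lie algebra is the vector space $\mathfrak L(\mathfrak g)=(\mathfrak g\otimes\mathbb C[t^{\pm1}])\oplus\mathbb C K_1\oplus\mathbb C K_2\oplus\bigoplus_{m\in\mathbb Z}\mathbb C d_m$ with brackets, for $x,y\in\mathfrak g$, $m,n\in\mathbb Z$: $[x\otimes t^m,y\otimes t^n]=[x,y]\otimes t^{m+n}+m(x,y)\delta_{m+n,0}K_1$; $[\mathfrak L(\mathfrak g),K_1]=[\mathfrak L(\mathfrak g),K_2]=0$; $[d_m,x\otimes t^n]=n\,x\otimes t^{m+n}$; $[d_m,d_n]=(n-m)d_{m+n}+\delta_{m+n,0}\frac{m^3-m}{12}K_2$. A biderivation of a Lie algebra $L$ is a bilinear map $F:L\times L\to L$ such that for all $x,y,z\in L$: $F([x,y],z)=[x,F(y,z)]-[y,F(x,z)]$ and $F(x,[y,z])=[y,F(x,z)]-[z,F(x,y)]$. It is skew-symmetric if $F(x,y)=-F(y,x)$ for all $x,y\in L$. A biderivation is inner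 if it has the form $F_\lambda(x,y)=\lambda[x,y]$ for some $\lambda\in\mathbb C$. *)

(* Defs.v *)
From HB Require Import structures.
From mathcomp Require Import all_boot all_order all_algebra finmap.
From mathcomp Require Import reals complex.
From mathcomp Require Import ring.
From mathcomp.multinomials Require Import monalg.

Set Implicit Arguments.
Unset Strict Implicit.
Unset Printing Implicit Defensive.

Import GRing.Theory Num.Theory passmx.
Local Open Scope ring_scope.

HB.mixin Record isLieAlgebra (K : fieldType) L of GRing.Lmodule K L := {
  lie : L -> L -> L;
  lie_linearl_subproof : forall y, linear (lie^~ y);
  lie_linearr_subproof : forall x, linear (lie x);
  liexx : forall x, lie x x = 0;
  lie_jacobi : forall x y z,
    lie x (lie y z) + lie y (lie z x) + lie z (lie x y) = 0
}.

#[short(type="lieAlgType")]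
HB.structure Definition LieAlgebra (K : fieldType) :=
  { L of isLieAlgebra K L & GRing.Lmodule K L }.

#[short(type="finLieAlgType")]
HB.structure Definition FinLieAlgebra (K : fieldType) :=
  { L of LieAlgebra K L & Vector K L }.

HB.instance Definition _ (K : fieldType) (L : lieAlgType K) :=
  bilinear_isBilinear.Build K L L L *:%R *:%R (@lie K L)
    (@lie_linearl_subproof K L, @lie_linearr_subproof K L).

HB.instance Definition _ (K : fieldType) (L : lieAlgType K) (x : L) :=
  GRing.isLinear.Build K L L *:%R (lie x) (lie_linearr_subproof x).

Section LieTheory.
Variables (K : fieldType) (L : lieAlgType K).
Implicit Types x y z : L.

Lemma lieC x y : lie x y = - lie y x.
Proof.
apply/eqP; rewrite -addr_eq0; apply/eqP.
by have := liexx (x + y); rewrite linearDl !linearDr /= !liexx add0r addr0.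
Qed.

Lemma lie_lie x y z : lie (lie x y) z = lie x (lie y z) - lie y (lie x z).
Proof.
rewrite [LHS]lieC (lieC x z) linearNr /= opprK; apply/esym/eqP.
by rewrite -addr_eq0 lie_jacobi.
Qed.

End LieTheory.

Section Biderivations.
Variables (K : fieldType) (L : lieAlgType K).
Implicit Type F : {bilinear L -> L -> L}.

Definition biderivation F : Prop :=
  (forall x y z, F (lie x y) z = lie x (F y z) - lie y (F x z)) /\
  (forall x y z, F x (lie y z) = lie y (F x z) - lie z (F x y)).

Definition skew_symmetric F : Prop := forall x y, F x y = - F y x.

Definition inner_biderivation F : Prop :=
  exists lambda : K, forall x y, F x y = lambda *: lie x y.

End Biderivations.

Section FiniteDimensional.
Variables (K : fieldType) (g : finLieAlgType K).
Implicit Types x y z : g.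

Definition lie_ideal (I : {vspace g}) : Prop :=
  forall x y, y \in I -> lie x y \in I.

Definition simple_lie : Prop :=
  (exists x y, lie x y != 0) /\
  (forall I : {vspace g}, lie_ideal I -> I = 0%VS \/ I = fullv).

Definition lie_ad x : 'End(g) := linfun (lie x).

Definition end_trace (f : 'End(g)) : K :=
  \tr (mxof (vbasis fullv) (vbasis fullv) f).

Definition killing x y : K := end_trace (lie_ad x \o lie_ad y)%VF.

Lemma lie_adE x y : lie_ad x y = lie x y. Proof. exact: lfunE. Qed.

Lemma lie_ad_linear : linear lie_ad.
Proof.
by move=> a x y; apply/lfunP => z; rewrite add_lfunE scale_lfunE !lie_adE linearPl.
Qed.
HB.instance Definition _ :=
  GRing.isLinear.Build K g 'End(g) *:%R lie_ad lie_ad_linear.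

Lemma end_trace_linear : scalar end_trace.
Proof. by move=> a f h; rewrite /end_trace linearP /= mxtraceD mxtraceZ. Qed.
HB.instance Definition _ :=
  GRing.isLinear.Build K 'End(g) K *%R end_trace end_trace_linear.

Lemma end_traceC (f h : 'End(g)) : end_trace (f \o h)%VF = end_trace (h \o f)%VF.
Proof.
have eb := vbasisP (fullv : {vspace g}).
by rewrite /end_trace !(mxof_comp _ _ eb) mxtrace_mulC.
Qed.

Lemma killing_bilinear : bilinear_for *%R *%R killing.
Proof.
split=> [z a x y | z a x y]; rewrite /killing linearP.
  by rewrite comp_lfunDl -comp_lfunZl linearP.
by rewrite comp_lfunDr -comp_lfunZr linearP.
Qed.
HB.instance Definition _ :=
  bilinear_isBilinear.Build K g g K *%R *%R killing killing_bilinear.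

Lemma killingC x y : killing x y = killing y x.
Proof. exact: end_traceC. Qed.

Lemma lie_ad_lie x y :
  lie_ad (lie x y) = ((lie_ad x \o lie_ad y) - (lie_ad y \o lie_ad x))%VF.
Proof.
apply/lfunP => z.
by rewrite add_lfunE opp_lfunE !comp_lfunE !lie_adE lie_lie.
Qed.

Lemma killing_lie x y z : killing (lie x y) z = killing x (lie y z).
Proof.
rewrite /killing !lie_ad_lie comp_lfunDl comp_lfunDr comp_lfunNl comp_lfunNr.
rewrite !raddfB /= comp_lfunA; congr (_ - _).
by rewrite -comp_lfunA end_traceC comp_lfunA.
Qed.

End FiniteDimensional.

(* Finitely supported families of elements of V indexed by the integers. This
   encodes both V (x) C[t^+-1], with [<< x *g m >>] for x (x) t^m, and (for
   V = K^o) the direct sum of the lines C d_m. *)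
Definition laurent (K : fieldType) (V : lmodType K) := {malg V[int]}.

HB.instance Definition _ (K : fieldType) (V : lmodType K) :=
  GRing.Zmodule.on (laurent V).

Section Laurent.
Variables (K : fieldType) (V : lmodType K).
Implicit Types p q : laurent V.

Definition laurent_scale (a : K) p : laurent V :=
  \sum_(m <- msupp p) << a *: p@_m *g m >>.

Lemma coef_laurent_scale a p m : (laurent_scale a p)@_m = a *: p@_m.
Proof.
rewrite [in RHS](monalgE p) !raddf_sum.
by apply: eq_bigr => k _ /=; rewrite !mcoeffU scalerMnr.
Qed.

Fact laurent_scaleA a b p :
  laurent_scale a (laurent_scale b p) = laurent_scale (a * b) p.
Proof. by apply/malgP => m; rewrite !coef_laurent_scale scalerA. Qed.

Fact laurent_scale1 : left_id 1 laurent_scale.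
Proof. by move=> p; apply/malgP => m; rewrite coef_laurent_scale scale1r. Qed.

Fact laurent_scaleDr : right_distributive laurent_scale +%R.
Proof.
move=> a p q; apply/malgP => m.
by rewrite !(mcoeffD, coef_laurent_scale) scalerDr.
Qed.

Fact laurent_scaleDl p : {morph laurent_scale^~ p : a b / a + b}.
Proof.
move=> a b; apply/malgP => m.
by rewrite !(mcoeffD, coef_laurent_scale) scalerDl.
Qed.

HB.instance Definition _ := GRing.Zmodule_isLmodule.Build K (laurent V)
  laurent_scaleA laurent_scale1 laurent_scaleDr laurent_scaleDl.

Lemma coef_laurentZ a p m : (a *: p)@_m = a *: p@_m.
Proof. exact: coef_laurent_scale. Qed.

Lemma monomial_linear (m : int) :
  linear ((fun x => << x *g m >>) : V -> laurent V).
Proof.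
move=> a x y; apply/malgP => k.
by rewrite mcoeffD coef_laurentZ !mcoeffU mulrnDl scalerMnr.
Qed.

End Laurent.

Lemma bil0l (K : fieldType) (U V W : lmodType K) (f : U -> V -> W) y :
  bilinear_for *:%R *:%R f -> f 0 y = 0.
Proof. by case=> /(_ y (-1) 0 0); rewrite /= scaler0 addr0 scaleN1r addNr. Qed.

Lemma bil0r (K : fieldType) (U V W : lmodType K) (f : U -> V -> W) x :
  bilinear_for *:%R *:%R f -> f x 0 = 0.
Proof. by case=> _ /(_ x (-1) 0 0); rewrite /= scaler0 addr0 scaleN1r addNr. Qed.

Section LaurentBilinear.
Variables (K : fieldType) (U V W : lmodType K).
Variable f : int -> int -> U -> V -> W.

(* When every f m n is bilinear, this is the bilinear map sending the pair
   (<< x *g m >>, << y *g n >>) to f m n x y: see [laurent_bilinE]. *)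
Definition laurent_bilin (p : laurent U) (q : laurent V) : W :=
  \sum_(m <- msupp p) \sum_(n <- msupp q) f m n p@_m q@_n.

Lemma laurent_bilin0l q : laurent_bilin 0 q = 0.
Proof. by rewrite /laurent_bilin msupp0 big_seq_fset0. Qed.

Lemma laurent_bilin0r p : laurent_bilin p 0 = 0.
Proof.
by rewrite /laurent_bilin big1 // => m _; rewrite msupp0 big_seq_fset0.
Qed.

Hypothesis f_bilin : forall m n, bilinear_for *:%R *:%R (f m n).

Lemma laurent_bilinEw (p : laurent U) (q : laurent V) (A B : {fset int}) :
  (msupp p `<=` A)%fset -> (msupp q `<=` B)%fset ->
  laurent_bilin p q = \sum_(m <- A) \sum_(n <- B) f m n p@_m q@_n.
Proof.
move=> sA sB; rewrite /laurent_bilin (big_fset_incl _ sA) /=; last first.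
  move=> m _ /mcoeff_outdom ->.
  by rewrite big1 // => n _; rewrite bil0l.
apply: eq_bigr => m _; rewrite (big_fset_incl _ sB) //=.
by move=> n _ /mcoeff_outdom ->; rewrite bil0r.
Qed.

Lemma laurent_bilin_bilinear : bilinear_for *:%R *:%R laurent_bilin.
Proof.
split=> [q a p1 p2|p a q1 q2].
  pose A := (msupp (a *: p1 + p2) `|` msupp p1 `|` msupp p2)%fset.
  have [s0 s1 s2] : [/\ msupp (a *: p1 + p2) `<=` A, msupp p1 `<=` A
                       & msupp p2 `<=` A]%fset.
    by split; apply/fsubsetP => k; rewrite !inE => ->; rewrite ?orbT.
  rewrite !(@laurent_bilinEw _ q A (msupp q)) //= scaler_sumr -big_split /=.
  apply: eq_bigr => m _; rewrite scaler_sumr -big_split /=.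
  apply: eq_bigr => n _.
  by rewrite mcoeffD coef_laurentZ (f_bilin m n).1.
pose A := (msupp (a *: q1 + q2) `|` msupp q1 `|` msupp q2)%fset.
have [s0 s1 s2] : [/\ msupp (a *: q1 + q2) `<=` A, msupp q1 `<=` A
                     & msupp q2 `<=` A]%fset.
  by split; apply/fsubsetP => k; rewrite !inE => ->; rewrite ?orbT.
rewrite !(@laurent_bilinEw p _ (msupp p) A) //= scaler_sumr -big_split /=.
apply: eq_bigr => m _; rewrite scaler_sumr -big_split /=.
apply: eq_bigr => n _.
by rewrite mcoeffD coef_laurentZ (f_bilin m n).2.
Qed.

Lemma laurent_bilinE m n x y :
  laurent_bilin << x *g m >> << y *g n >> = f m n x y.
Proof.
have s k (X : zmodType) (z : X) := @msuppU_le int X k z.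
rewrite (laurent_bilinEw (s _ _ _) (s _ _ _)) !big_seq_fset1.
by rewrite !mcoeffUU.
Qed.

End LaurentBilinear.

Lemma laurent_bilinN (K : fieldType) (U V W : lmodType K)
    (f : int -> int -> U -> V -> W) (f' : int -> int -> V -> U -> W) p q :
  (forall m n x y, f m n x y = - f' n m y x) ->
  laurent_bilin f p q = - laurent_bilin f' q p.
Proof.
move=> ff'; rewrite /laurent_bilin exchange_big -sumrN /=.
by apply: eq_bigr => n _; rewrite -sumrN; apply: eq_bigr => m _; rewrite ff'.
Qed.

Section Jacobiator.
Variables (K : fieldType) (V : lmodType K) (br : V -> V -> V).
Hypothesis br_bilin : bilinear_for *:%R *:%R br.
Implicit Types u v w t : V.

Definition jacobiator u v w := br u (br v w) + br v (br w u) + br w (br u v).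

Lemma jacobiator_rot u v w : jacobiator u v w = jacobiator v w u.
Proof. by rewrite /jacobiator -addrA addrC. Qed.

Lemma brDl u v w : br (u + v) w = br u w + br v w.
Proof. by have := br_bilin.1 w 1 u v; rewrite /= !scale1r. Qed.
Lemma brDr u v w : br u (v + w) = br u v + br u w.
Proof. by have := br_bilin.2 u 1 v w; rewrite /= !scale1r. Qed.
Lemma brZl a u v : br (a *: u) v = a *: br u v.
Proof. by have := br_bilin.1 v a u 0; rewrite /= (bil0l _ br_bilin) !addr0. Qed.
Lemma brZr a u v : br u (a *: v) = a *: br u v.
Proof. by have := br_bilin.2 u a v 0; rewrite /= (bil0r _ br_bilin) !addr0. Qed.

Lemma jacobiatorD u v w t :
  jacobiator (u + v) w t = jacobiator u w t + jacobiator v w t.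
Proof.
by rewrite /jacobiator !(brDl, brDr) (addrACA (br u _)) (addrACA (br u _ + _)).
Qed.

Lemma jacobiatorZ a u v w : jacobiator (a *: u) v w = a *: jacobiator u v w.
Proof. by rewrite /jacobiator !(brZl, brZr) -!scalerDr. Qed.

Lemma jacobiator_central c u v : (forall u, br u c = 0) -> (forall u, br c u = 0) ->
  jacobiator c u v = 0.
Proof.
by move=> cr cl; rewrite /jacobiator !cl !cr !(bil0r _ br_bilin) !addr0.
Qed.

End Jacobiator.

(* The Jacobi identity is checked for an abstract bracket given on generators, so
   that unification does not unfold the concrete one. *)
Section Presentation.
Variables (K : numFieldType) (g : finLieAlgType K) (V : lmodType K).
Variables (br : V -> V -> V) (tens : g -> int -> V) (K1 K2 : V) (d : int -> V).
Hypothesis br_bilin : bilinear_for *:%R *:%R br.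
Hypothesis brC : forall u v, br u v = - br v u.
Hypothesis tensD : forall m x y, tens (x + y) m = tens x m + tens y m.
Hypothesis tensZ : forall m a x, tens (a *: x) m = a *: tens x m.
Hypothesis br_tens : forall x y m n, br (tens x m) (tens y n) =
  tens (lie x y) (m + n) + ((m + n == 0)%:R * (m%:~R * killing x y)) *: K1.
Hypothesis br_d_tens : forall x m n,
  br (d m) (tens x n) = n%:~R *: tens x (m + n).
Hypothesis br_d : forall m n, br (d m) (d n) = (n - m)%:~R *: d (m + n)
  + ((m + n == 0)%:R * ((m ^+ 3 - m)%:~R / 12%:R)) *: K2.
Hypothesis br_K1 : forall u, br u K1 = 0.
Hypothesis br_K2 : forall u, br u K2 = 0.
Hypothesis span : forall P : V -> Prop,
  (forall u v, P u -> P v -> P (u + v)) ->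
  (forall x m, P (tens x m)) -> (forall a, P (a *: K1)) ->
  (forall a, P (a *: K2)) -> (forall a m, P (a *: d m)) -> forall u, P u.

Local Notation jac := (jacobiator br).
Let brDr := brDr br_bilin.
Let brZr := brZr br_bilin.

Let br_tens_d x m n : br (tens x n) (d m) = - (n%:~R *: tens x (m + n)).
Proof. by rewrite brC br_d_tens. Qed.

Let sum3 (t1 t2 t3 k : V) (c1 c2 c3 : K) :
  (t1 + c1 *: k) + (t2 + c2 *: k) + (t3 + c3 *: k) =
  (t1 + t2 + t3) + (c1 + c2 + c3) *: k.
Proof. by rewrite !scalerDl (addrACA t1) (addrACA (t1 + t2)). Qed.

Let tens0 m : tens 0 m = 0.
Proof. by have := tensZ m 0 0; rewrite !scale0r. Qed.

Let tensN m x : tens (- x) m = - tens x m.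
Proof. by have := tensZ m (-1) x; rewrite !scaleN1r. Qed.

Let jac_ttt x y z m n p : jac (tens x m) (tens y n) (tens z p) = 0.
Proof.
rewrite /jacobiator !br_tens !brDr !brZr !br_K1 !scaler0 !addr0 !br_tens.
have -> : (n + (p + m) = m + (n + p))%R by ring.
have -> : (p + (m + n) = m + (n + p))%R by ring.
rewrite sum3 -!tensD lie_jacobi.
rewrite tens0 add0r.
case: eqP => [e|_]; last by rewrite !mul0r !addr0 scale0r.
have -> : p = - (m + n) by rewrite -[LHS](addKr (m + n)) -addrA e addr0.
rewrite -[killing y _]killing_lie [killing _ x]killingC.
rewrite [killing z _]killingC killing_lie !mul1r -!mulrDl -!rmorphD /=.
by rewrite subrr mulr0z mul0r scale0r.
Qed.

Let jac_dtt y z m n p : jac (d m) (tens y n) (tens z p) = 0.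
Proof.
rewrite /jacobiator !(br_tens, br_d_tens, br_tens_d) !brDr !brZr br_K1 scaler0 addr0.
rewrite -scaleN1r !brZr !(br_tens, br_d_tens).
have -> : m + (n + p) = n + (m + p) by ring.
have -> : p + (m + n) = n + (m + p) by ring.
rewrite (lieC z y) (killingC z y).
set t := tens (lie y z) _.
rewrite tensN -/t.
rewrite !scalerDr !scalerN !scalerA -!scaleNr.
rewrite (addrA (_ *: t)) addrACA -!scalerDl.
rewrite [X in X *: t](_ : _ = 0) ?[X in _ + X *: _](_ : _ = 0); try by ring.
by rewrite !scale0r addr0.
Qed.

Let jac_ddt z m n p : jac (d m) (d n) (tens z p) = 0.
Proof.
rewrite /jacobiator !(br_d, br_d_tens, br_tens_d) !brDr !brZr br_K2 scaler0 addr0.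
rewrite -scaleN1r !brZr !(br_d, br_d_tens, br_tens_d).
have -> : n + (m + p) = m + (n + p) by ring.
have -> : m + n + p = m + (n + p) by ring.
rewrite !scalerN !scalerA -!scaleNr -!scalerDl.
by rewrite [X in X *: _](_ : _ = 0) ?scale0r //; ring.
Qed.

Let jac_ddd m n p : jac (d m) (d n) (d p) = 0.
Proof.
rewrite /jacobiator !br_d !brDr !brZr !br_K2 !scaler0 !addr0 !br_d.
have -> : (n + (p + m) = m + (n + p))%R by ring.
have -> : (p + (m + n) = m + (n + p))%R by ring.
rewrite !scalerDr !scalerA sum3 -!scalerDl.
rewrite [X in X *: d _](_ : _ = 0) ?scale0r ?add0r; last by ring.
case: eqP => [e|_]; last by rewrite !mul0r !mulr0 !addr0 scale0r.
have -> : p = - (m + n) by rewrite -[LHS](addKr (m + n)) -addrA e addr0.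
by rewrite [X in X *: _](_ : _ = 0) ?scale0r //; field.
Qed.

Lemma presented_jacobi u v w : jac u v w = 0.
Proof.
have ind (J : V -> V) : (forall u v, J (u + v) = J u + J v) ->
    (forall a u, J (a *: u) = a *: J u) -> J K1 = 0 -> J K2 = 0 ->
    (forall x m, J (tens x m) = 0) -> (forall m, J (d m) = 0) ->
    forall u, J u = 0.
  move=> JD JZ J1 J2 Jt Jd; apply: span => //.
  - by move=> u' v' Ju Jv; rewrite JD Ju Jv addr0.
  - by move=> a; rewrite JZ J1 scaler0.
  - by move=> a; rewrite JZ J2 scaler0.
  - by move=> a m; rewrite JZ Jd scaler0.
have ind3 v1 w1 : (forall x m, jac (tens x m) v1 w1 = 0) ->
    (forall m, jac (d m) v1 w1 = 0) -> forall u1, jac u1 v1 w1 = 0.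
  move=> Jt Jd; apply: (ind (fun u1 => jac u1 v1 w1)) => //.
  - by move=> *; apply: jacobiatorD.
  - by move=> *; apply: jacobiatorZ.
  - by apply: jacobiator_central => // t; rewrite brC br_K1 oppr0.
  - by apply: jacobiator_central => // t; rewrite brC br_K2 oppr0.
apply: (ind3) => [x m | m]; rewrite jacobiator_rot; apply: (ind3) => [y n | n];
  rewrite jacobiator_rot; apply: (ind3) => [z p | p].
- exact: jac_ttt.
- exact: jac_dtt.
- by rewrite jacobiator_rot jacobiator_rot; apply: jac_dtt.
- by rewrite jacobiator_rot jacobiator_rot; apply: jac_ddt.
- by rewrite jacobiator_rot; apply: jac_dtt.
- exact: jac_ddt.
- by rewrite jacobiator_rot; apply: jac_ddt.
- exact: jac_ddd.
Qed.

End Presentation.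

Section AffineVirasoro.
Variables (K : numFieldType) (g : finLieAlgType K).

(* (g (x) C[t^+-1]) (+) C K_1 (+) C K_2 (+) (+)_m C d_m *)
Record affvir : Type := AffVir {
  av_loop : laurent g;
  av_K1_coef : K;
  av_K2_coef : K;
  av_vir : laurent (K^o : lmodType K)
}.

Implicit Types (u v w : affvir) (x y z : g) (m n p : int).

Lemma affvirP u v : av_loop u = av_loop v -> av_K1_coef u = av_K1_coef v ->
  av_K2_coef u = av_K2_coef v -> av_vir u = av_vir v -> u = v.
Proof. by case: u v => [? ? ? ?] [? ? ? ?] /= -> -> -> ->. Qed.

Let to_prod u := (av_loop u, av_K1_coef u, av_K2_coef u, av_vir u).
Let of_prod t := let: (p, a, b, q) := t in AffVir p a b q.
Let to_prodK : cancel to_prod of_prod. Proof. by case. Qed.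
HB.instance Definition _ := Choice.copy affvir (can_type to_prodK).

Definition affvir_zero := AffVir 0 0 0 0.
Definition affvir_opp u :=
  AffVir (- av_loop u) (- av_K1_coef u) (- av_K2_coef u) (- av_vir u).
Definition affvir_add u v :=
  AffVir (av_loop u + av_loop v) (av_K1_coef u + av_K1_coef v)
         (av_K2_coef u + av_K2_coef v) (av_vir u + av_vir v).
Definition affvir_scale (a : K) u :=
  AffVir (a *: av_loop u) (a * av_K1_coef u) (a * av_K2_coef u) (a *: av_vir u).

Fact affvir_addA : associative affvir_add.
Proof. by move=> u v w; apply: affvirP; rewrite /= addrA. Qed.
Fact affvir_addC : commutative affvir_add.
Proof. by move=> u v; apply: affvirP; rewrite /= addrC. Qed.
Fact affvir_add0 : left_id affvir_zero affvir_add.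
Proof. by move=> u; apply: affvirP; rewrite /= add0r. Qed.
Fact affvir_addN : left_inverse affvir_zero affvir_opp affvir_add.
Proof. by move=> u; apply: affvirP; rewrite /= addNr. Qed.
HB.instance Definition _ := GRing.isZmodule.Build affvir
  affvir_addA affvir_addC affvir_add0 affvir_addN.

Fact affvir_scaleA a b u :
  affvir_scale a (affvir_scale b u) = affvir_scale (a * b) u.
Proof. by apply: affvirP; rewrite /= ?scalerA ?mulrA. Qed.
Fact affvir_scale1 : left_id 1 affvir_scale.
Proof. by move=> u; apply: affvirP; rewrite /= ?scale1r ?mul1r. Qed.
Fact affvir_scaleDr : right_distributive affvir_scale +%R.
Proof. by move=> a u v; apply: affvirP; rewrite /= ?scalerDr ?mulrDr. Qed.
Fact affvir_scaleDl u : {morph affvir_scale^~ u : a b / a + b}.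
Proof. by move=> a b; apply: affvirP; rewrite /= ?scalerDl ?mulrDl. Qed.
HB.instance Definition _ := GRing.Zmodule_isLmodule.Build K affvir
  affvir_scaleA affvir_scale1 affvir_scaleDr affvir_scaleDl.

(* [av_tens x m] is x (x) t^m. *)
Definition av_tens x m : affvir := AffVir << x *g m >> 0 0 0.
Definition av_K1 : affvir := AffVir 0 1 0 0.
Definition av_K2 : affvir := AffVir 0 0 1 0.
Definition av_d m : affvir := AffVir 0 0 0 << (1 : K^o) *g m >>.

(* The three functions below give the brackets [x (x) t^m, y (x) t^n],
   [a d_m, x (x) t^n] and [a d_m, b d_n]; [(m + n == 0)%:R] is the Kronecker
   delta of m + n and 0. *)
Definition av_lie_loop m n x y : affvir :=
  av_tens (lie x y) (m + n) + ((m + n == 0)%:R * (m%:~R * killing x y)) *: av_K1.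

Definition av_lie_vir_loop m n (a : K^o) x : affvir :=
  (a * n%:~R) *: av_tens x (m + n).

Definition av_lie_vir m n (a b : K^o) : affvir :=
  (a * b) *: ((n - m)%:~R *: av_d (m + n)
              + ((m + n == 0)%:R * ((m ^+ 3 - m)%:~R / 12%:R)) *: av_K2).

(* The term with a minus sign is [x (x) t^n, a d_m] = - [a d_m, x (x) t^n]. *)
Definition av_lie u v : affvir :=
  laurent_bilin av_lie_loop (av_loop u) (av_loop v)
  + laurent_bilin av_lie_vir_loop (av_vir u) (av_loop v)
  - laurent_bilin av_lie_vir_loop (av_vir v) (av_loop u)
  + laurent_bilin av_lie_vir (av_vir u) (av_vir v).

Lemma av_tens_linear m : linear (av_tens^~ m).
Proof.
move=> a x y; apply: affvirP; rewrite /= ?mulr0 ?scaler0 ?addr0 //.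
exact: monomial_linear.
Qed.

Lemma av_tensD m x y : av_tens (x + y) m = av_tens x m + av_tens y m.
Proof. by have := av_tens_linear m 1 x y; rewrite !scale1r. Qed.

Lemma av_tens0 m : av_tens 0 m = 0.
Proof. by apply: (addrI (av_tens 0 m)); rewrite -av_tensD !addr0. Qed.

Lemma av_tensZ m a x : av_tens (a *: x) m = a *: av_tens x m.
Proof. by have := av_tens_linear m a x 0; rewrite av_tens0 !addr0. Qed.

Lemma av_tensN m x : av_tens (- x) m = - av_tens x m.
Proof. by rewrite -scaleN1r av_tensZ scaleN1r. Qed.

Let scale_bilin (c : K) m : bilinear_for *:%R *:%R
  (fun (a : K^o) x => (a * c) *: av_tens x m).
Proof.
split=> [x b a1 a2|a b x1 x2] /=.
  by rewrite mulrDl scalerDl -mulrA scalerA.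
by rewrite av_tens_linear scalerDr !scalerA (mulrC b).
Qed.

Let kronD (c d a k l : K) : c * (d * (a * k + l)) = a * (c * (d * k)) + c * (d * l).
Proof. by rewrite mulrDr mulrDr !(mulrCA a). Qed.

Let scale_add2 (a b c d : K) (s t e : affvir) : c = a * b + d ->
  a *: s + t + c *: e = a *: (s + b *: e) + (t + d *: e).
Proof. by move=> ->; rewrite scalerDl -scalerA addrACA -scalerDr. Qed.

Lemma av_lie_loop_bilin m n : bilinear_for *:%R *:%R (av_lie_loop m n).
Proof.
split=> [z a x y|z a x y] /=; rewrite /av_lie_loop.
  rewrite (lie_linearl_subproof z a) (killing_bilinear g).1 av_tens_linear.
  exact/scale_add2/kronD.
rewrite (lie_linearr_subproof z a) (killing_bilinear g).2 av_tens_linear.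
exact/scale_add2/kronD.
Qed.

Lemma av_lie_vir_loop_bilin m n : bilinear_for *:%R *:%R (av_lie_vir_loop m n).
Proof. exact: scale_bilin. Qed.

Lemma av_lie_vir_bilin m n : bilinear_for *:%R *:%R (av_lie_vir m n).
Proof.
split=> [c a x y|c a x y] /=; rewrite /av_lie_vir scalerA -scalerDl.
  by rewrite [in LHS]mulrDl -mulrA.
by rewrite [in LHS]mulrDr mulrCA.
Qed.

Let blo := laurent_bilin_bilinear av_lie_loop_bilin.
Let bvl := laurent_bilin_bilinear av_lie_vir_loop_bilin.
Let bvi := laurent_bilin_bilinear av_lie_vir_bilin.

Let lin4 (V : lmodType K) (a : K) (A B C D A' B' C' D' : V) :
  a *: A + A' + (a *: B + B') - (a *: C + C') + (a *: D + D')
  = a *: (A + B - C + D) + (A' + B' - C' + D').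
Proof.
rewrite opprD (addrACA (a *: A)) (addrACA (a *: A + _)) (addrACA (a *: A + _ - _)).
by rewrite !scalerDr scalerN.
Qed.

Lemma av_lie_bilinear : bilinear_for *:%R *:%R av_lie.
Proof.
split=> [w a u v|w a u v] /=; rewrite /av_lie.
  rewrite (blo.1 _ a (av_loop u)) (bvl.1 _ a (av_vir u)).
  rewrite (bvl.2 _ a (av_loop u)) (bvi.1 _ a (av_vir u)) /=.
  exact: lin4.
rewrite (blo.2 _ a (av_loop u)) (bvl.2 _ a (av_loop u)).
rewrite (bvl.1 _ a (av_vir u)) (bvi.2 _ a (av_vir u)) /=.
exact: lin4.
Qed.

Let lb0 := (laurent_bilin0l, laurent_bilin0r).

Lemma av_lie_tens x y m n : av_lie (av_tens x m) (av_tens y n) =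
  av_tens (lie x y) (m + n) + ((m + n == 0)%:R * (m%:~R * killing x y)) *: av_K1.
Proof.
by rewrite /av_lie (laurent_bilinE av_lie_loop_bilin) !lb0 subr0 !addr0.
Qed.

Lemma av_lie_d_tens x m n :
  av_lie (av_d m) (av_tens x n) = n%:~R *: av_tens x (m + n).
Proof.
rewrite /av_lie (laurent_bilinE av_lie_vir_loop_bilin) !lb0.
by rewrite subr0 addr0 add0r /av_lie_vir_loop mul1r.
Qed.

Lemma av_lie_d m n : av_lie (av_d m) (av_d n) =
  (n - m)%:~R *: av_d (m + n)
  + ((m + n == 0)%:R * ((m ^+ 3 - m)%:~R / 12%:R)) *: av_K2.
Proof.
rewrite /av_lie (laurent_bilinE av_lie_vir_bilin) !lb0.
by rewrite subr0 !add0r /av_lie_vir mul1r scale1r.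
Qed.

Lemma av_lie_K1 u : av_lie u av_K1 = 0.
Proof. by rewrite /av_lie !lb0 subr0 !addr0. Qed.

Lemma av_lie_K2 u : av_lie u av_K2 = 0.
Proof. by rewrite /av_lie !lb0 subr0 !addr0. Qed.

Lemma av_lieC u v : av_lie u v = - av_lie v u.
Proof.
have killN x y m n : (m + n == 0)%:R * (m%:~R * killing x y) =
    - ((n + m == 0)%:R * (n%:~R * killing y x)) :> K.
  rewrite killingC addrC; case: eqP => [e|_]; last by rewrite !mul0r oppr0.
  by rewrite -(addrK m n) e add0r mulrNz; ring.
have virN m n : (m + n == 0)%:R * ((m ^+ 3 - m)%:~R / 12%:R) =
    - ((n + m == 0)%:R * ((n ^+ 3 - n)%:~R / 12%:R)) :> K.
  rewrite addrC; case: eqP => [e|_]; last by rewrite !mul0r oppr0.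
  rewrite -(addrK m n) e add0r !mul1r -mulNr -mulrNz; congr (_%:~R / _); ring.
rewrite /av_lie !opprD opprK.
rewrite (laurent_bilinN (f' := av_lie_loop)); last first.
  move=> m n x y; rewrite /av_lie_loop killN lieC (addrC m n).
  by rewrite scaleNr opprD av_tensN.
rewrite (laurent_bilinN (f' := av_lie_vir) (av_vir u)); last first.
  move=> m n a b; rewrite /av_lie_vir virN (addrC m n) (mulrC a).
  by rewrite -scalerN opprD -!scaleNr -mulrNz opprB.
by rewrite -!addrA; congr (_ + _); rewrite !addrA (addrC (laurent_bilin _ _ _)).
Qed.

Lemma av_liexx u : av_lie u u = 0.
Proof.
apply/eqP; have := scaler_eq0 (2%:R : K) (av_lie u u).
by rewrite scaler_nat mulr2n {1}av_lieC addNr eqxx pnatr_eq0 /= => <-.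
Qed.

Lemma affvir_ind (P : affvir -> Prop) :
  (forall u v, P u -> P v -> P (u + v)) ->
  (forall x m, P (av_tens x m)) -> (forall a, P (a *: av_K1)) ->
  (forall a, P (a *: av_K2)) -> (forall a m, P (a *: av_d m)) ->
  forall u, P u.
Proof.
move=> PD Pt P1 P2 Pd u.
have P0 : P 0 by rewrite -(scale0r av_K1).
have -> : u = \sum_(m <- msupp (av_loop u)) av_tens (av_loop u)@_m m
    + av_K1_coef u *: av_K1 + av_K2_coef u *: av_K2
    + \sum_(m <- msupp (av_vir u)) (av_vir u)@_m *: av_d m.
  have loop_sum r (F : int -> affvir) :
      av_loop (\sum_(i <- r) F i) = \sum_(i <- r) av_loop (F i).
    by elim/big_rec2: _ => //= i _ ? _ <-.
  have vir_sum r (F : int -> affvir) :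
      av_vir (\sum_(i <- r) F i) = \sum_(i <- r) av_vir (F i).
    by elim/big_rec2: _ => //= i _ ? _ <-.
  have K1_sum r (F : int -> affvir) :
      av_K1_coef (\sum_(i <- r) F i) = \sum_(i <- r) av_K1_coef (F i).
    by elim/big_rec2: _ => //= i _ ? _ <-.
  have K2_sum r (F : int -> affvir) :
      av_K2_coef (\sum_(i <- r) F i) = \sum_(i <- r) av_K2_coef (F i).
    by elim/big_rec2: _ => //= i _ ? _ <-.
  apply: affvirP; rewrite /= ?(loop_sum, vir_sum, K1_sum, K2_sum) /=.
  - rewrite !scaler0 !addr0 [X in _ + X]big1 ?addr0; last first.
      by move=> m _; rewrite scaler0.
    exact: monalgE.
  - rewrite big1_eq add0r mulr1 mulr0 addr0 big1 ?addr0 // => m _.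
    exact: mulr0.
  - rewrite big1_eq add0r mulr1 mulr0 add0r big1 ?addr0 // => m _.
    exact: mulr0.
  - rewrite !scaler0 !addr0 big1_eq add0r [LHS]monalgE; apply: eq_bigr => m _.
    apply/malgP => k; rewrite coef_laurentZ !mcoeffU /GRing.scale /=.
    by rewrite mulrnAr mulr1.
apply: (PD); last first.
  by elim/big_ind: _ => // m _; apply: Pd.
apply: (PD) => //; apply: (PD) => //.
by elim/big_ind: _ => // m _; apply: Pt.
Qed.

Lemma av_lie_jacobi u v w : jacobiator av_lie u v w = 0.
Proof.
apply: (presented_jacobi av_lie_bilinear av_lieC av_tensD av_tensZ av_lie_tens
  av_lie_d_tens av_lie_d av_lie_K1 av_lie_K2 affvir_ind).
Qed.

HB.instance Definition _ := isLieAlgebra.Build K affvir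
  av_lie_bilinear.1 av_lie_bilinear.2 av_liexx av_lie_jacobi.

End AffineVirasoro.

(* Main.v *)
From HB Require Import structures.
Require Import Defs.
From mathcomp Require Import all_boot all_order all_algebra.
From mathcomp Require Import reals complex.
From mathcomp Require Import ring zify.
From mathcomp.multinomials Require Import monalg.

Set Implicit Arguments.
Unset Strict Implicit.
Unset Printing Implicit Defensive.

Import GRing.Theory Num.Theory.
Local Open Scope ring_scope.

(** The proof compares F with the bracket by means of one identity, valid for a
    skew-symmetric biderivation F of any Lie algebra in characteristic other
    than 2 ([biderivation_lie_exchange]):

      [[x, y], F(u, v)] = [F(x, y), [u, v]].

    Let L be the affine-Virasoro algebra and Z the span of K_1 and K_2, which is
    central. Take x = u = d_0, y = d_m and v = d_n: as [d_0, d_n] = n d_n, the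
    identity relates F(d_0, d_m) to F(d_0, d_n). Moreover F(d_0, _) is a
    derivation that kills d_0, so it preserves the grading of L by ad d_0.
    Comparing coefficients gives a scalar lambda, independent of n, with
    F(d_0, d_n) = lambda [d_0, d_n] modulo Z ([d0_coef_free]).

    Put G = F - lambda [_, _], again a skew-symmetric biderivation, with
    G(d_0, d_n) in Z for all n. The identity with u = d_0 and v = d_n says that
    each value G(x, y) commutes with d_n for n <> 0, which leaves only the
    g (x) t^0 part of G(x, y) modulo Z. Then G(d_0, z (x) t), having
    degree 1, is in Z, so each G(x, y) also commutes with g (x) t; since the
    simple Lie algebra g has trivial center, G(x, y) is in Z ([biderivation_coef_free]).

    Finally, a skew-symmetric biderivation G with central values vanishes
    ([central_biderivation0]): it kills [L, L] in each argument, L is spanned by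
    [L, L] and K_1, and G(K_1, K_1) = 0. *)

(** * Skew-symmetric biderivations of an arbitrary Lie algebra *)

Section SkewBiderivation.
Variables (K : numFieldType) (L : lieAlgType K) (F : {bilinear L -> L -> L}).
Hypotheses (hF : biderivation F) (hskew : skew_symmetric F).

Definition lie_defect x y u v := lie (lie x y) (F u v) - lie (F x y) (lie u v).

(** The two sides of the equation come from expanding F([x, u], [y, v]) by the
    derivation rule in the first argument first, or in the second one first. *)
Lemma lie_defect_exchange x y u v : lie_defect x y u v = lie_defect x v u y.
Proof.
have shuffle (a b c d a' b' c' d' : L) :
    a - b - (c - d) = a' - c' - (b' - d') ->
    a - a' + (d - d') = b - b' + (c - c').
  rewrite !opprB !(addrACA _ (- _)) -!opprD (addrC c' b').
  move/eqP; rewrite subr_eq => /eqP ->.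
  by rewrite addrC -(addrA (a' + d')) addKr addrC.
have := hF.1 x u (lie y v).
rewrite (hF.2 (lie x u)) !hF.1 !hF.2 !linearB /= => e.
rewrite /lie_defect (lieC (F x y)) (lieC (F x v)) !opprK !lie_lie.
by apply: shuffle; rewrite !opprD.
Qed.

(** The defect changes sign under x <-> y and is invariant under y <-> v.
    Alternating three transpositions of each kind leads back to the starting
    point with the opposite sign, so the defect equals its own opposite. *)
Lemma biderivation_lie_exchange x y u v :
  lie (lie x y) (F u v) = lie (F x y) (lie u v).
Proof.
have skewl a b c d : lie_defect a b c d = - lie_defect b a c d.
  by rewrite /lie_defect (lieC a b) (hskew a b) !linearNl /= opprD.
have e : lie_defect x y u v = - lie_defect x y u v.
  rewrite {1}lie_defect_exchange skewl lie_defect_exchange skewl opprK.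
  by rewrite lie_defect_exchange skewl.
apply/eqP; rewrite -subr_eq0 -/(lie_defect x y u v).
have := scaler_eq0 (2%:R : K) (lie_defect x y u v).
by rewrite scaler_nat mulr2n {1}e addNr eqxx pnatr_eq0 /= => <-.
Qed.

Definition biderivation_shift (lambda : K) x y := F x y - lambda *: lie x y.

Lemma biderivation_shift_bilinear lambda :
  bilinear_for *:%R *:%R (biderivation_shift lambda).
Proof.
have lin (a b : K) (t t' s s' : L) : a *: t + t' - b *: (a *: s + s') =
    a *: (t - b *: s) + (t' - b *: s').
  by rewrite scalerDr opprD addrACA scalerBr !scalerA mulrC.
split=> [y a x x'|x a y y'] /=; rewrite /biderivation_shift.
  rewrite [F _ y]linearPl lie_linearl_subproof /=. exact: lin.
by rewrite [F x _]linearP lie_linearr_subproof /=; exact: lin.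
Qed.
HB.instance Definition _ lambda := bilinear_isBilinear.Build K L L L *:%R *:%R
  (biderivation_shift lambda) (biderivation_shift_bilinear lambda).

Lemma biderivation_shiftP lambda : biderivation (biderivation_shift lambda).
Proof.
have lin (t t' s s' : L) : t - t' - lambda *: (s - s') =
    t - lambda *: s - (t' - lambda *: s').
  by rewrite scalerBr !opprD addrACA.
have lieS a b c : lie a (b - lambda *: c) = lie a b - lambda *: lie a c.
  by rewrite linearB linearZ.
split=> x y z /=; rewrite /biderivation_shift !lieS -lin.
  by rewrite hF.1 lie_lie.
rewrite hF.2; congr (_ - _ *: _).
by rewrite (lieC z) opprK lie_lie addrC subrK.
Qed.

Lemma biderivation_shift_skew lambda : skew_symmetric (biderivation_shift lambda).
Proof.
move=> x y; rewrite /= /biderivation_shift hskew lieC scalerN opprK.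
by rewrite opprB addrC.
Qed.

End SkewBiderivation.

(** * Lie algebras satisfying the affine-Virasoro relations *)

(** The argument uses only the brackets of the generators and the coefficient
    forms. The Lie algebra is kept abstract because reduction would otherwise
    expand the concrete bracket into its defining double sums. *)
Section AffineVirasoroRelations.
Variables (K : numFieldType) (g L : lieAlgType K).
Variables (tens : g -> int -> L) (K1 K2 : L) (d : int -> L).
Variables (kappa : g -> g -> K).
Variables (loop : int -> {linear L -> g}) (vir : int -> {scalar L}).
Implicit Types (x y z : g) (u v w : L) (j k m n : int).

Hypothesis lie_tens : forall x y m n, lie (tens x m) (tens y n) =
  tens (lie x y) (m + n) + ((m + n == 0)%:R * (m%:~R * kappa x y)) *: K1.
Hypothesis lie_d_tens : forall x m n,
  lie (d m) (tens x n) = n%:~R *: tens x (m + n).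
Hypothesis lie_d : forall m n, lie (d m) (d n) = (n - m)%:~R *: d (m + n)
  + ((m + n == 0)%:R * ((m ^+ 3 - m)%:~R / 12%:R)) *: K2.
Hypothesis lie_K1 : forall u, lie u K1 = 0.
Hypothesis lie_K2 : forall u, lie u K2 = 0.
Hypothesis span : forall P : L -> Prop,
  (forall u v, P u -> P v -> P (u + v)) ->
  (forall x m, P (tens x m)) -> (forall a, P (a *: K1)) ->
  (forall a, P (a *: K2)) -> (forall a m, P (a *: d m)) -> forall u, P u.

Hypothesis loop_tens : forall k x m, loop k (tens x m) = x *+ (m == k).
Hypothesis loop_d : forall k m, loop k (d m) = 0.
Hypothesis loop_K1 : forall k, loop k K1 = 0.
Hypothesis loop_K2 : forall k, loop k K2 = 0.
Hypothesis vir_tens : forall k x m, vir k (tens x m) = 0.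
Hypothesis vir_d : forall k m, vir k (d m) = (m == k)%:R.
Hypothesis vir_K1 : forall k, vir k K1 = 0.
Hypothesis vir_K2 : forall k, vir k K2 = 0.

(** In the affine-Virasoro algebra, these are the elements of the span of K_1
    and K_2. *)
Definition coef_free w := (forall k, loop k w = 0) /\ (forall k, vir k w = 0).
Hypothesis coef_free_central : forall w u, coef_free w -> lie u w = 0.

Let coefE := (loop_tens, loop_d, loop_K1, loop_K2, vir_tens, vir_d, vir_K1, vir_K2).
Let lieE := (lie_d_tens, lie_d, lie_tens, lie_K1, lie_K2).

Lemma loop_lie_d n k w : loop k (lie (d n) w) = (k - n)%:~R *: loop (k - n) w.
Proof.
elim/span: w => [u v hu hv|x m|a|a|a m].
- by rewrite !linearD /= hu hv.
- rewrite lieE linearZ /= !coefE; have [->|ne] := eqVneq m (k - n).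
    by rewrite (addrC n) subrK eqxx.
  have [e|_] := eqVneq; last by rewrite !scaler0.
  by case/eqP: ne; rewrite -e addrC addKr.
- by rewrite !linearZ /= lieE !coefE linear0 !scaler0.
- by rewrite !linearZ /= lieE !coefE linear0 !scaler0.
- by rewrite !linearZ /= lieE linearD !linearZ /= !coefE !(scaler0, addr0).
Qed.

Lemma vir_lie_d n k w : vir k (lie (d n) w) = (k - n - n)%:~R * vir (k - n) w.
Proof.
elim/span: w => [u v hu hv|x m|a|a|a m].
- by rewrite !linearD /= hu hv -?mulrDr.
- by rewrite lieE !linearZ /= !coefE !mulr0.
- by rewrite !linearZ /= lieE !coefE linear0 !mulr0.
- by rewrite !linearZ /= lieE !coefE linear0 !mulr0.
- rewrite !linearZ /= lieE linearD !linearZ /= !coefE !(mulr0, addr0).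
  rewrite [RHS]mulrCA; congr (_ * _); have [->|ne] := eqVneq m (k - n).
    by rewrite (addrC n) subrK eqxx.
  have [e|_] := eqVneq; last by rewrite !mulr0.
  by case/eqP: ne; rewrite -e addrC addKr.
Qed.

Lemma loop_lie_tens n k w y :
  loop k (lie w (tens y n)) = lie (loop (k - n) w) y + (n%:~R * vir (k - n) w) *: y.
Proof.
have eqk m : (m + n == k) = (m == k - n) by rewrite eq_sym -subr_eq eq_sym.
elim/span: w => [u v hu hv|x m|a|a|a m].
- by rewrite linearDl !linearD linearDl /= hu hv mulrDr scalerDl addrACA.
- rewrite lieE linearD linearZ /= !coefE scaler0 mulr0 scale0r !addr0 eqk.
  by case: eqP => _; rewrite ?mulr1n // mulr0n linear0l.
- rewrite linearZl_LR !linearZ /= lieC lieE !coefE oppr0 linear0 !scaler0.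
  by rewrite linear0l mulr0 mulr0 scale0r addr0.
- rewrite linearZl_LR !linearZ /= lieC lieE !coefE oppr0 linear0 !scaler0.
  by rewrite linear0l mulr0 mulr0 scale0r addr0.
- rewrite linearZl_LR !linearZ /= lieE !linearZ /= !coefE scaler0 linear0l add0r eqk.
  case: eqP => _; last by rewrite !scaler0 !mulr0 scale0r.
  by rewrite mulr1n mulr1 scalerA mulrC.
Qed.

Lemma lie_d0 n : lie (d 0) (d n) = n%:~R *: d n.
Proof. by rewrite lieE subr0 add0r expr0n subrr mul0r mulr0 scale0r addr0. Qed.

Let intr_scaler_eq0 (V : lmodType K) n (v : V) : n != 0 -> n%:~R *: v = 0 -> v = 0.
Proof.
by move=> n0 /eqP; rewrite scaler_eq0 intr_eq0 (negPf n0) => /eqP.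
Qed.

Let intr_mul_eq0 n (a : K) : n != 0 -> n%:~R * a = 0 -> a = 0.
Proof. by move=> n0 /eqP; rewrite mulf_eq0 intr_eq0 (negPf n0) => /eqP. Qed.

(** In [d_n, w] the coefficient of d_j in w is multiplied by j - n, so it is
    enough to find a nonzero n other than j. *)
Lemma vir_commuting w :
  (forall n, n != 0 -> lie (d n) w = 0) -> forall j, vir j w = 0.
Proof.
move=> wd j; pose n : int := if j == 1 then 2 else 1.
have [n0 nj] : n != 0 /\ j - n != 0.
  by rewrite /n; case: (eqVneq j 1) => [->|j1]; rewrite // subr_eq0.
have := vir_lie_d n (j + n) w.
by rewrite addrK wd // linear0 => /esym /(intr_mul_eq0 nj).
Qed.

Lemma loop_commuting w :
  (forall n, n != 0 -> lie (d n) w = 0) -> forall j, j != 0 -> loop j w = 0.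
Proof.
move=> wd j j0; have := loop_lie_d 1 (j + 1) w.
by rewrite addrK wd // linear0 => /esym /(intr_scaler_eq0 j0).
Qed.

(** * Values of a skew-symmetric biderivation modulo the central elements *)

Section ValuesModuloCenter.
Variable F : {bilinear L -> L -> L}.
Hypotheses (hF : biderivation F) (hskew : skew_symmetric F).

Lemma skew_diag u : F u u = 0.
Proof.
have := scaler_eq0 (2%:R : K) (F u u).
by rewrite scaler_nat mulr2n {1}hskew addNr eqxx pnatr_eq0 /= => /esym /eqP.
Qed.

Lemma biderivation_d0 v : F (d 0) (lie (d 0) v) = lie (d 0) (F (d 0) v).
Proof. by rewrite hF.2 skew_diag linear0 subr0. Qed.

Lemma d0_exchange m n :
  n%:~R *: lie (d n) (F (d 0) (d m)) + m%:~R *: lie (d m) (F (d 0) (d n)) = 0.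
Proof.
have := biderivation_lie_exchange hF hskew (d 0) (d m) (d 0) (d n).
rewrite !lie_d0 linearZl_LR linearZ /= => ->.
by rewrite lieC scalerN addNr.
Qed.

(** For n <> 0, [biderivation_d0] makes F(d_0, d_n) an eigenvector of ad d_0 with
    eigenvalue n, so only the coefficient at t^n is left; the case m = n of
    [d0_exchange] says that d_n commutes with F(d_0, d_n), which kills it. *)
Lemma d0_loop n k : loop k (F (d 0) (d n)) = 0.
Proof.
have [->|n0] := eqVneq n 0; first by rewrite skew_diag linear0.
have [->|kn] := eqVneq k n.
  have := congr1 (loop (n + n)) (d0_exchange n n).
  rewrite -scalerDl linearZ /= loop_lie_d addrK linear0 -mulrzDr.
  by move/intr_scaler_eq0/intr_scaler_eq0; apply=> //; lia.
have := congr1 (loop k) (biderivation_d0 (d n)).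
rewrite lie_d0 !linearZ /= loop_lie_d subr0 => /esym /eqP.
by rewrite -subr_eq0 -scalerBl -mulrzBr => /eqP /intr_scaler_eq0; apply; lia.
Qed.

(** The degree argument leaves the coefficient of d_n, say p(n). The exchange of
    1 and n gives (n - 1) p(n) = n (n - 1) p(1): hence p(n) = n p(1). *)
Lemma d0_vir n k : vir k (F (d 0) (d n)) =
  (vir 1 (F (d 0) (d 1)) * n%:~R) * (n == k)%:R.
Proof.
have [->|n0] := eqVneq n 0; first by rewrite skew_diag linear0 mulr0 mul0r.
have [<-|kn] := eqVneq n k.
  have [->|n1] := eqVneq n 1; first by rewrite !mulr1.
  have := congr1 (vir (1 + n)) (d0_exchange 1 n).
  rewrite linearD !linearZ /= !vir_lie_d linear0.
  have [-> ->] : 1 + n - n = 1 /\ 1 + n - 1 = n by split; lia.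
  rewrite mul1r.
  rewrite mulr1 => h.
  have : (n - 1)%:~R * (vir n (F (d 0) (d n)) - vir 1 (F (d 0) (d 1)) * n%:~R) = 0.
    by rewrite -[RHS]h; ring.
  have n10 : n - 1 != 0 by rewrite subr_eq0.
  by move/(intr_mul_eq0 n10)/eqP; rewrite subr_eq0 => /eqP.
have := congr1 (vir k) (biderivation_d0 (d n)).
rewrite lie_d0 !linearZ /= vir_lie_d subr0 subr0 mulr0 => /esym /eqP.
by rewrite -subr_eq0 -mulrBl -mulrzBr => /eqP /intr_mul_eq0; apply; lia.
Qed.

Lemma d0_coef_free : exists lambda,
  forall n, coef_free (F (d 0) (d n) - lambda *: lie (d 0) (d n)).
Proof.
exists (vir 1 (F (d 0) (d 1))) => n; rewrite lie_d0; split=> k.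
  by rewrite linearB d0_loop scalerA [loop _ (_ *: _)]linearZ /= coefE scaler0 subr0.
by rewrite linearB (d0_vir n k) scalerA [vir _ (_ *: _)]linearZ /= coefE subrr.
Qed.

Hypothesis d0_free : forall n, coef_free (F (d 0) (d n)).
Hypothesis centerless : forall x, (forall y, lie x y = 0) -> x = 0.

Lemma biderivation_coef_free u v : coef_free (F u v).
Proof.
have comm_d u' v' n : n != 0 -> lie (d n) (F u' v') = 0.
  move=> n0; have := biderivation_lie_exchange hF hskew u' v' (d 0) (d n).
  rewrite (coef_free_central _ (d0_free n)) lie_d0 linearZ /= => /esym.
  by move/(intr_scaler_eq0 n0) => e; rewrite lieC e oppr0.
have v0 u' v' := vir_commuting (comm_d u' v').
have l0 u' v' := loop_commuting (comm_d u' v').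
have lie_d0_tens1 z : lie (d 0) (tens z 1) = tens z 1.
  by rewrite lie_d_tens add0r scale1r.
(* [biderivation_d0] gives degree 1 to this value, and only degree 0 is left. *)
have tens1_free z : coef_free (F (d 0) (tens z 1)).
  split=> // k; have [->|/l0->//] := eqVneq k 0.
  have := congr1 (loop 0) (biderivation_d0 (tens z 1)).
  by rewrite lie_d0_tens1 loop_lie_d subr0 scale0r.
split=> // k; have [->|/l0->//] := eqVneq k 0; apply: centerless => y.
have := congr1 (loop 1) (biderivation_lie_exchange hF hskew u v (d 0) (tens y 1)).
rewrite (coef_free_central _ (tens1_free y)) lie_d0_tens1 loop_lie_tens.
by rewrite subrr v0 mulr0 scale0r addr0 linear0.
Qed.

End ValuesModuloCenter.

(** * Biderivations with central values *)

(** If the values are central, the derivation rule gives F([u, v], w) = 0, so F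
    vanishes as soon as its first argument is a commutator; all generators but
    K_1 are seen to be in [L, L]. *)
Lemma central_biderivation0 (F : {bilinear L -> L -> L}) :
  biderivation F -> skew_symmetric F -> (forall u v, coef_free (F u v)) ->
  forall u v, F u v = 0.
Proof.
move=> hF hskew Fc.
have F_lie u v w : F (lie u v) w = 0.
  by rewrite hF.1 !(coef_free_central _ (Fc _ _)) subrr.
(* [d_(m+1), x (x) t^-1] = - x (x) t^m, which covers m = 0 as well. *)
have F_tens x m w : F (tens x m) w = 0.
  have := F_lie (d (m + 1)) (tens x (- 1)) w.
  by rewrite lie_d_tens addrK linearZl_LR; apply: intr_scaler_eq0.
have F_d m w : F (d m) w = 0.
  have [->|m0] := eqVneq m 0.
    have := F_lie (d 1) (d (- 1)) w.
    rewrite lie_d expr1n subrr mul0r mulr0 scale0r addr0 linearZl_LR.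
    exact: intr_scaler_eq0.
  by have := F_lie (d 0) (d m) w; rewrite lie_d0 linearZl_LR; apply: intr_scaler_eq0.
(* [d_2, d_-2] = -4 d_0 + (1/2) K_2. *)
have F_K2 w : F K2 w = 0.
  have := F_lie (d 2) (d (- 2)) w.
  rewrite lie_d subrr eqxx mul1r linearDl !linearZl_LR F_d scaler0 add0r.
  have c0 : ((2 ^+ 3 - 2)%:~R / 12%:R : K) != 0.
    by rewrite mulf_neq0 ?invr_eq0 ?intr_eq0 ?pnatr_eq0.
  by move/eqP; rewrite scaler_eq0 (negPf c0) => /eqP.
(* Skew-symmetry reduces to the generators above and to F(K_1, K_1) = 0. *)
have F_K1 w : F K1 w = 0.
  elim/span: w => [u v hu hv|x m|a|a|a m].
  - by rewrite linearD /= hu hv addr0.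
  - by rewrite hskew F_tens oppr0.
  - by rewrite linearZ /= skew_diag ?scaler0.
  - by rewrite linearZ /= hskew F_K2 oppr0 scaler0.
  - by rewrite linearZ /= hskew F_d oppr0 scaler0.
move=> u w; elim/span: u => [u v hu hv|x m|a|a|a m] //.
- by rewrite linearDl /= hu hv addr0.
- by rewrite linearZl_LR /= F_K1 scaler0.
- by rewrite linearZl_LR /= F_K2 scaler0.
- by rewrite linearZl_LR /= F_d scaler0.
Qed.

Lemma presented_inner (F : {bilinear L -> L -> L}) :
  (forall x, (forall y, lie x y = 0) -> x = 0) ->
  biderivation F -> skew_symmetric F -> inner_biderivation F.
Proof.
move=> centerless hF hskew; have [lambda free] := d0_coef_free hF hskew.
have hG := biderivation_shiftP hF lambda.
have sG := biderivation_shift_skew hskew lambda.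
have Gfree := biderivation_coef_free hG sG free centerless.
have G0 := central_biderivation0 hG sG Gfree.
by exists lambda => u v; apply/eqP; rewrite -subr_eq0; apply/eqP; apply: G0.
Qed.

End AffineVirasoroRelations.

(** * The affine-Virasoro algebra of a simple Lie algebra *)

Section AffineVirasoroCoefficients.
Variables (K : numFieldType) (g : finLieAlgType K).

Definition loop_coef k (w : affvir g) : g := (av_loop w)@_k.
Definition vir_coef k (w : affvir g) : K := (av_vir w)@_k.

Lemma loop_coef_linear k : linear (loop_coef k).
Proof. by move=> a u v; rewrite /= /loop_coef mcoeffD coef_laurentZ. Qed.
HB.instance Definition _ k := GRing.isLinear.Build K (affvir g) g *:%R
  (loop_coef k) (loop_coef_linear k).

Lemma vir_coef_linear k : scalar (vir_coef k).
Proof. by move=> a u v; rewrite /vir_coef mcoeffD coef_laurentZ. Qed.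
HB.instance Definition _ k := GRing.isLinear.Build K (affvir g) K *%R
  (vir_coef k) (vir_coef_linear k).

Lemma affvir_inner (F : {bilinear affvir g -> affvir g -> affvir g}) :
  (forall x : g, (forall y, lie x y = 0) -> x = 0) ->
  biderivation F -> skew_symmetric F -> inner_biderivation F.
Proof.
apply: (@presented_inner K g (affvir g) (@av_tens K g) (av_K1 g) (av_K2 g)
  (@av_d K g) (@killing K g) (fun k => loop_coef k) (fun k => vir_coef k)).
- exact: av_lie_tens.
- exact: av_lie_d_tens.
- exact: av_lie_d.
- exact: av_lie_K1.
- exact: av_lie_K2.
- exact: affvir_ind.
- by move=> k x m; rewrite /= /loop_coef mcoeffU.
- by move=> k m; rewrite /= /loop_coef mcoeff0.
- by move=> k; rewrite /= /loop_coef mcoeff0.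
- by move=> k; rewrite /= /loop_coef mcoeff0.
- by move=> k x m; rewrite /= /vir_coef mcoeff0.
- by move=> k m; rewrite /= /vir_coef mcoeffU.
- by move=> k; rewrite /= /vir_coef mcoeff0.
- by move=> k; rewrite /= /vir_coef mcoeff0.
move=> w u [loop0 vir0].
have wl : av_loop w = 0 by apply/malgP => k; rewrite mcoeff0; apply: loop0.
have wv : av_vir w = 0 by apply/malgP => k; rewrite mcoeff0; apply: vir0.
rewrite /lie /= /av_lie wl wv !(laurent_bilin0l, laurent_bilin0r).
by rewrite subr0 !addr0.
Qed.

End AffineVirasoroCoefficients.

(** The center is an ideal, being the kernel of ad, and it is proper because the
    bracket is nonzero. *)
Lemma simple_lie_centerless (K : fieldType) (g : finLieAlgType K) (x : g) :
  simple_lie g -> (forall y, lie x y = 0) -> x = 0.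
Proof.
move=> [[a [b ab]] simple] xz.
pose Z : {vspace g} := lker (linfun (@lie_ad K g)).
have inZ u : reflect (forall v, lie u v = 0) (u \in Z).
  rewrite memv_ker lfunE; apply: (iffP eqP) => [u0 v|u0].
    by rewrite -lie_adE /= u0 zero_lfunE.
  by apply/lfunP => v; rewrite /= lie_adE u0 zero_lfunE.
have Zideal : lie_ideal Z.
  by move=> u v /inZ v0; rewrite lieC v0 oppr0 mem0v.
case: (simple Z Zideal) => ZE.
  by apply/eqP; rewrite -memv0 -ZE; apply/inZ.
by have /inZ a0 : a \in Z; [rewrite ZE memvf | rewrite a0 eqxx in ab].
Qed.

Theorem corollary3p5 (R : realType) (g : finLieAlgType R[i])
    (hg : simple_lie g)
    (F : {bilinear affvir g -> affvir g -> affvir g})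
    (hF : biderivation F) (hskew : skew_symmetric F) :
  inner_biderivation F.
Proof.
by apply: affvir_inner => // x; apply: simple_lie_centerless.
Qed.
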